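(* Let $\rho_{C|Z}\in\mathcal{C}_{C|Z}$. Let $\gamma$ be a positive function of $DZ$. Let $B$ be a function of $CZ$ satisfying $$1-\mathbb{E}_\sigma(B(CZ))\ge\max_{dz}\gamma(dz)\sigma(d|z)\quad\text{for all }\sigma\in\mathcal{C}_{C|Z}\rtimes\mathrm{Unif}_Z .$$ Assume that $\bar b=\mathbb{E}_{\rho_{C|Z}\rtimes\mathrm{Unif}_Z}(B)>0$. Let $\nu$ be a distribution of $Z$ with $p_{\min}=\min_z\nu(z)>0$. Then the asymptotic gain rate at $\rho_{C|Z}\rtimes\nu$ of $\mathcal{C}_{C|Z}\rtimes\nu$ is at least $$-\log(1-\bar b)+\mathbb{E}_{\rho_{C|Z}\rtimes\nu}\log(\gamma(DZ)).$$
   Context: All random variables have finite value spaces; $\mathrm{Rng}(X)$ is the value space of $X$ and $\mathrm{Unif}_Z$ the uniform distribution on $\mathrm{Rng}(Z)$. $D$ is a function of $C$. $\log$ is natural with $\log0=-\infty$; expectations are sums over values of positive probability only. $\mathcal{C}_{C|Z}$ is a fixed closed convex set of families $(\rho_{C|z})_{z\in\mathrm{Rng}(Z)}$ of distributions of $C$. For such a family and a distribution $\nu$ of $Z$, $(\rho_{C|Z}\rtimes\nu)(cz)=\rho_{C|z}(c)\nu(z)$, and $\mathcal{C}_{C|Z}\rtimes\nu=\{\sigma_{C|Z}\rtimes\nu:\sigma_{C|Z}\in\mathcal{C}_{C|Z}\}$. PEF: a probability estimation factor with power $\beta>0$ for a set $\mathcal{C}$ of distributions of $CZ$ (and $D|Z$)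 is a non-negative function $F=F(CZ)$ such that $\mathbb{E}_\sigma(F(CZ)\,\sigma(D|Z)^\beta)\le1$ for all $\sigma\in\mathcal{C}$. Its log-prob rate at a distribution $\rho$ is $\mathbb{E}_\rho(\log F(CZ))/\beta$. The asymptotic gain rate at $\rho$ of $\mathcal{C}$ is the supremum of the log-prob rates at $\rho$ achievable by PEFs with positive power for $\mathcal{C}$. *)

(* Defs.v *)
From mathcomp Require Import all_boot all_order all_algebra.
From mathcomp Require Import all_classical all_reals all_analysis.
Import Order.TTheory GRing.Theory Num.Theory.
Import numFieldNormedType.Exports.

Set Implicit Arguments.
Unset Strict Implicit.
Unset Printing Implicit Defensive.

Local Open Scope classical_set_scope.
Local Open Scope ring_scope.

Section PEF.
Context {R : realType}.

Definition is_distr (T : finType) (mu : T -> R) : Prop :=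
  (forall t, 0 <= mu t) /\ \sum_t mu t = 1.

Definition fin_expectation (T : finType) (mu f : T -> R) : R :=
  \sum_(t | 0 < mu t) mu t * f t.

Definition fin_expectation_ereal (T : finType) (mu : T -> R) (f : T -> \bar R) :
    \bar R :=
  (\sum_(t | (0 < mu t)%R) (mu t)%:E * f t)%E.

(* The library's [lne] sends 0 to -oo. *)
Definition log (x : R) : \bar R := lne x%:E.

Definition unif (T : finType) : T -> R := fun=> #|T|%:R^-1.

Context {TC TZ TD : finType}.

(* A family [rho] of distributions of C indexed by z is a map
   [TZ -> TC -> R], with [rho z c] the probability of c given z. *)

Definition rtimes (rho : TZ -> TC -> R) (nu : TZ -> R) : TC * TZ -> R :=
  fun cz => rho cz.2 cz.1 * nu cz.2.

Definition rtimes_set (CZ : set (TZ -> TC -> R)) (nu : TZ -> R) :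
    set (TC * TZ -> R) :=
  [set rtimes sigma nu | sigma in CZ].

(* Closedness in the topology of pointwise convergence, which for finite
   [TC] and [TZ] is the Euclidean one. *)
Definition closed_family (CZ : set (TZ -> TC -> R)) : Prop :=
  closed (CZ : set {ptws TZ -> {ptws TC -> R}}).

Definition convex_family (CZ : set (TZ -> TC -> R)) : Prop :=
  @convex_set R (TZ -> TC -> R^o) CZ.

Variable D : TC -> TD.

(* sigma(d|z), the conditional probability of D = d given Z = z; it is 0 by
   convention when z has probability 0. *)
Definition condD (sigma : TC * TZ -> R) (d : TD) (z : TZ) : R :=
  (\sum_(c | D c == d) sigma (c, z)) / \sum_c sigma (c, z).

Definition is_PEF (S : set (TC * TZ -> R)) (beta : R) (F : TC * TZ -> R) :
    Prop :=
  [/\ 0 < beta,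
      forall cz, 0 <= F cz &
      forall sigma, S sigma ->
        fin_expectation sigma
          (fun cz => F cz * condD sigma (D cz.1) cz.2 `^ beta) <= 1].

Definition log_prob_rate (rho : TC * TZ -> R) (beta : R) (F : TC * TZ -> R) :
    \bar R :=
  (fin_expectation_ereal rho (fun cz => log (F cz)) * (beta^-1)%:E)%E.

Definition asymptotic_gain_rate (S : set (TC * TZ -> R))
    (rho : TC * TZ -> R) : \bar R :=
  ereal_sup [set r | exists beta F,
    is_PEF S beta F /\ r = log_prob_rate rho beta F].

End PEF.

(* Main.v *)
(* Reweight B to W = B / (|Z| nu), so that the expectation of W at
   sigma >< nu is that of B at sigma >< Unif, and is bbar at rho. For small
   beta > 0 put
     F = (gamma / (1 - bbar)) ^ beta * (1 + beta (W - bbar) / (1 - bbar)).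
   Since gamma sigma(d|z) <= 1 - E_sigma W, the PEF inequality reduces to
   x ^ beta (1 + beta (1 - x)) <= 1 for x = (1 - E_sigma W) / (1 - bbar), whose
   left-hand side is maximal, equal to 1, at x = 1 (that is, at rho). The linear
   correction has mean 0 at rho, so it costs O(beta) in the log-prob rate, and
   beta -> 0 gives the bound. *)
Require Import Defs.
From mathcomp Require Import all_boot all_order all_algebra.
From mathcomp Require Import all_classical all_reals all_analysis.
From mathcomp Require Import ring lra.

Set Implicit Arguments.
Unset Strict Implicit.

Import Order.TTheory GRing.Theory Num.Theory.
Import numFieldNormedType.Exports.
Local Open Scope classical_set_scope.
Local Open Scope ring_scope.

(** Since [1 + u <= expR u] at [u = beta * (1 - x)], the product is at most
    [expR (beta * (ln x + 1 - x))], and [ln x <= x - 1]. The point [x = 0] is separate: there the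
    power vanishes because [beta > 0]. *)
Lemma powR_mul_tangent_le1 (R : realType) (x beta : R) :
  0 <= x -> 0 < beta -> x `^ beta * (1 + beta * (1 - x)) <= 1.
Proof.
move=> x_ge0 beta_gt0; have [->|x_neq0] := eqVneq x 0.
  by rewrite powR0 ?gt_eqF// mul0r.
have x_gt0 : 0 < x by rewrite lt_neqAle eq_sym x_neq0.
rewrite /powR (negbTE x_neq0).
apply: (@le_trans _ _ (expR (beta * ln x) * expR (beta * (1 - x)))).
  by rewrite ler_wpM2l ?expR_ge0// expR_ge1Dx.
rewrite -expRD -[leRHS]expR0 ler_expR -mulrDr pmulr_rle0//.
have : ln (1 + (x - 1)) <= x - 1 by apply: le_ln1Dx; lra.
by rewrite (_ : 1 + (x - 1) = x) => [ln_le|]; [lra|ring].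
Qed.

(** Applying [ln (1 + u) <= u] to the inverse of [1 + y] gives [ln (1 + y) >= y / (1 + y)]. This
    dominates [y - 2 * y ^+ 2] as soon as [1 + 2 * y >= 0]. *)
Lemma ln1D_ge (R : realType) (y : R) :
  `|y| <= 1 / 2 -> y - 2 * y ^+ 2 <= ln (1 + y).
Proof.
rewrite ler_norml => /andP[y_lo y_hi].
have y1_gt0 : 0 < 1 + y by lra.
have : ln (1 + ((1 + y)^-1 - 1)) <= (1 + y)^-1 - 1.
  by apply: le_ln1Dx; rewrite ltrBrDr addrC subrr invr_gt0.
rewrite (_ : 1 + _ = (1 + y)^-1); last by ring.
rewrite lnV ?posrE// => le_ln.
have y_inv : (1 + y)^-1 - 1 <= - y + 2 * y ^+ 2.
  rewrite lerBlDr -[_^-1]mul1r ler_pdivrMr//.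
  have := sqr_ge0 y; nra.
lra.
Qed.

(** Chooses the power: [1 + beta * A] stays away from 0, and the quadratic error
    [2 * (beta * A) ^+ 2] of its logarithm is still at most [eps] after division by [beta]. *)
Lemma ex_small_scale (R : realType) (T : finType) (A : T -> R) (eps : R) :
  0 < eps -> exists beta : R, [/\ 0 < beta,
    forall t, `|beta * A t| <= 1 / 2 &
    forall t, 2 * (beta * A t ^+ 2) <= eps].
Proof.
(* A uniform bound on [A]; the added 1 keeps it positive when [A] is zero. *)
move=> eps_gt0; pose M := 1 + \sum_t `|A t|.
have A_le t : `|A t| <= M.
  rewrite /M (bigD1 t)//=.
  have : 0 <= \sum_(i | i != t) `|A i| by apply: sumr_ge0.
  lra.
have M_ge1 : 1 <= M by rewrite /M lerDl sumr_ge0.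
have M_gt0 : 0 < M by lra.
exists (Num.min (2 * M)^-1 (eps / (2 * M ^+ 2))).
set beta := Num.min _ _.
have beta_gt0 : 0 < beta.
  by rewrite lt_min invr_gt0 divr_gt0 ?mulr_gt0 ?exprn_gt0.
have : beta <= (2 * M)^-1 by rewrite ge_min lexx.
rewrite -[_^-1]mul1r ler_pdivlMr ?mulr_gt0// => beta_le1.
have : beta <= eps / (2 * M ^+ 2) by rewrite ge_min lexx orbT.
rewrite ler_pdivlMr ?mulr_gt0 ?exprn_gt0// => beta_le2.
split=> // t.
  have : `|beta * A t| <= beta * M by rewrite normrM gtr0_norm// ler_pM2l.
  nra.
apply: le_trans beta_le2.
rewrite mulrCA ler_pM2l// ler_pM2l// -real_normK ?num_real//.
by rewrite ler_pXn2r ?nnegrE// ltW.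
Qed.

Section FinExpectation.
Context {R : realType} {T : finType}.
Implicit Types mu f g : T -> R.

Lemma fin_expectationE mu f : (forall t, 0 <= mu t) ->
  fin_expectation mu f = \sum_t mu t * f t.
Proof.
move=> mu_ge0; rewrite /fin_expectation big_mkcond; apply: eq_bigr => t _.
case: ltP => // mu_le0.
by rewrite (@le_anti _ _ (mu t) 0) ?mul0r ?mu_le0 ?mu_ge0.
Qed.

Lemma ler_fin_expectation mu f g : (forall t, 0 < mu t -> f t <= g t) ->
  fin_expectation mu f <= fin_expectation mu g.
Proof.
by move=> le_fg; apply: ler_sum => t mu_gt0; rewrite ler_pM2l// le_fg.
Qed.

Lemma fin_expectation_affine mu f (a b : R) : is_distr mu ->
  fin_expectation mu (fun t => a + b * f t) = a + b * fin_expectation mu f.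
Proof.
move=> [mu_ge0 mu1]; rewrite !fin_expectationE//.
under eq_bigr do rewrite mulrDr mulrCA.
by rewrite big_split/= -mulr_suml mu1 mul1r -mulr_sumr.
Qed.

Lemma fin_expectationD mu f g :
  fin_expectation mu (fun t => f t + g t) =
  fin_expectation mu f + fin_expectation mu g.
Proof.
by rewrite /fin_expectation -big_split; apply: eq_bigr => t _; rewrite mulrDr.
Qed.

Lemma fin_expectation_log mu f : (forall t, 0 < f t) ->
  fin_expectation_ereal mu (fun t => log (f t)) =
  (fin_expectation mu (fun t => ln (f t)))%:E.
Proof.
move=> f_gt0; rewrite /fin_expectation_ereal /fin_expectation -sumEFin.
by apply: eq_bigr => t _; rewrite /log lne_EFin// EFinM.
Qed.

End FinExpectation.

Section Family.
Context {R : realType} {TC TZ TD : finType}.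
Variable D : TC -> TD.
Implicit Types (sigma : TZ -> TC -> R) (nu : TZ -> R).

Lemma rtimes_distr sigma nu : (forall z, is_distr (sigma z)) -> is_distr nu ->
  is_distr (rtimes sigma nu).
Proof.
move=> sigma_distr [nu_ge0 nu1]; split=> [[c z]|].
  by rewrite mulr_ge0//; case: (sigma_distr z).
rewrite -(pair_bigA _ (fun c z => sigma z c * nu z))/= exchange_big/= -nu1.
apply: eq_bigr => z _; rewrite -mulr_suml.
by have [_ ->] := sigma_distr z; rewrite mul1r.
Qed.

Lemma unif_distr : (0 < #|TZ|)%N -> is_distr (@unif R TZ).
Proof.
move=> TZ_gt0; split=> [z|]; first by rewrite /unif invr_ge0.
by rewrite /unif sumr_const -[LHS]mulr_natl divff// pnatr_eq0 -lt0n.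
Qed.

(** The weight [nu z] cancels, so the hypothesis on [gamma], given for uniform Z, can be carried
    over to [nu]. *)
Lemma condD_rtimes sigma nu d z : is_distr (sigma z) -> 0 < nu z ->
  condD D (rtimes sigma nu) d z = \sum_(c | D c == d) sigma z c.
Proof.
move=> [_ sigma1] nu_gt0; rewrite /condD /rtimes/= -!mulr_suml sigma1 mul1r.
by rewrite mulfK ?gt_eqF.
Qed.

Lemma condD_ge0 (mu : TC * TZ -> R) d z : (forall cz, 0 <= mu cz) ->
  0 <= condD D mu d z.
Proof. by move=> mu_ge0; rewrite divr_ge0 ?sumr_ge0. Qed.

End Family.

Lemma tangent_PEF (R : realType) (TC TZ TD : finType) (D : TC -> TD)
    (S : set (TC * TZ -> R)) (gamma : TD * TZ -> R) (W : TC * TZ -> R)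
    (b beta : R) :
  (forall mu, S mu -> is_distr mu) -> (forall dz, 0 < gamma dz) ->
  (forall mu, S mu -> forall d z,
     gamma (d, z) * condD D mu d z <= 1 - fin_expectation mu W) ->
  b < 1 -> 0 < beta ->
  (forall cz, 0 <= 1 + beta * ((W cz - b) / (1 - b))) ->
  is_PEF D S beta (fun cz => (gamma (D cz.1, cz.2) / (1 - b)) `^ beta
                             * (1 + beta * ((W cz - b) / (1 - b)))).
Proof.
move=> S_distr gamma_gt0 bound b_lt1 beta_gt0 lin_ge0.
have b1_gt0 : 0 < 1 - b by rewrite subr_gt0.
split=> // [cz|mu Smu]; first by rewrite mulr_ge0 ?powR_ge0.
have [mu_ge0 mu1] := S_distr _ Smu.
set x := (1 - fin_expectation mu W) / (1 - b).
have x_ge0 : 0 <= x.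
  (* The bound needs some point to be evaluated at; one exists because [mu] has total mass 1. *)
  have [[c z] _|mu0] := pickP [pred cz : TC * TZ | true]; last first.
    by move: mu1; rewrite big_pred0// => /eqP; rewrite eq_sym oner_eq0.
  rewrite divr_ge0 ?(ltW b1_gt0)//; apply: le_trans (bound _ Smu (D c) z).
  by rewrite mulr_ge0 ?condD_ge0// ltW.
apply: le_trans (@powR_mul_tangent_le1 _ x beta x_ge0 beta_gt0).
(* Here [gamma * condD / (1 - b)] has been replaced by its upper bound [x], and the linear factor
   expanded as an affine function of [W]. Taking expectations yields [1 + beta * (1 - x)], as
   [1 - x] is [(fin_expectation mu W - b) / (1 - b)]. *)
pose E := fin_expectation mu (fun cz =>
  x `^ beta * (1 - beta * b / (1 - b)) + x `^ beta * beta / (1 - b) * W cz).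
apply: (@le_trans _ _ E).
  apply: ler_fin_expectation => -[c z] _ /=.
  rewrite [leRHS](_ : _ = x `^ beta * (1 + beta * ((W (c, z) - b) / (1 - b)))).
    have g_ge0 : 0 <= gamma (D c, z) / (1 - b) by rewrite ltW ?divr_gt0.
    have q_ge0 := condD_ge0 D (D c) z mu_ge0.
    rewrite mulrAC ler_wpM2r// -powRM//
      ge0_ler_powR ?nnegrE ?(ltW beta_gt0) ?(mulr_ge0 g_ge0 q_ge0)//.
    by rewrite [leLHS]mulrAC ler_pM2r ?invr_gt0// bound.
  by field; rewrite gt_eqF.
rewrite /E fin_expectation_affine// le_eqVlt; apply/orP; left; apply/eqP.
by rewrite [in RHS]/x; field; rewrite gt_eqF.
Qed.

(** The logarithm of the factor is [beta * ln g + ln (1 + beta * A)], whose second term is at least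
    [beta * A - beta * eps]. The mean of [A] is 0, so dividing by [beta] loses only [eps]. *)
Lemma tangent_log_prob_rate_ge (R : realType) (T TZ : finType)
    (mu : T * TZ -> R) (g A : T * TZ -> R) (beta eps : R) :
  is_distr mu -> (forall t, 0 < g t) -> fin_expectation mu A = 0 ->
  0 < beta -> (forall t, `|beta * A t| <= 1 / 2) ->
  (forall t, 2 * (beta * A t ^+ 2) <= eps) ->
  ((fin_expectation mu (fun t => ln (g t)) - eps)%:E <=
   log_prob_rate mu beta (fun t => g t `^ beta * (1 + beta * A t))%R)%E.
Proof.
move=> mu_distr g_gt0 EA beta_gt0 A_small A2_small.
have lin_gt0 t : 0 < 1 + beta * A t.
  by have := A_small t; rewrite ler_norml => /andP[]; lra.
rewrite /log_prob_rate fin_expectation_log => [|t]; last first.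
  by rewrite mulr_gt0 ?powR_gt0.
rewrite -EFinM lee_fin ler_pdivlMr//.
apply: (@le_trans _ _ (fin_expectation mu
  (fun t => (- (beta * eps) + beta * ln (g t)) + beta * A t))).
  rewrite fin_expectationD fin_expectation_affine//.
  have := @fin_expectation_affine _ _ mu A 0 beta mu_distr.
  rewrite EA mulr0 add0r /fin_expectation => H.
  under [X in _ <= _ + X]eq_bigr do rewrite -[beta * A _]add0r.
  rewrite H; nra.
apply: ler_fin_expectation => t _.
rewrite lnM ?posrE ?powR_gt0// ln_powR.
have := ln1D_ge (A_small t); have := A2_small t; nra.
Qed.

Unset Implicit Arguments.
Set Strict Implicit.

Theorem theorem49 (R : realType) (TC TZ TD : finType) (D : TC -> TD)
  (CZ : set (TZ -> TC -> R))
  (CZ_distr : forall sigma, CZ sigma -> forall z, is_distr (sigma z))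
  (CZ_closed : closed_family CZ)
  (CZ_convex : convex_family CZ)
  (rho : TZ -> TC -> R) (CZ_rho : CZ rho)
  (gamma : TD * TZ -> R) (gamma_gt0 : forall dz, 0 < gamma dz)
  (B : TC * TZ -> R)
  (B_bound : forall sigma, rtimes_set CZ (@unif R TZ) sigma ->
     forall d z, gamma (d, z) * condD D sigma d z <= 1 - fin_expectation sigma B)
  (bbar : R) (bbarE : bbar = fin_expectation (rtimes rho (@unif R TZ)) B)
  (bbar_gt0 : 0 < bbar)
  (nu : TZ -> R) (nu_distr : is_distr nu) (nu_gt0 : forall z, 0 < nu z) :
  (- log (1 - bbar)
     + fin_expectation_ereal (rtimes rho nu)
         (fun cz => log (gamma (D cz.1, cz.2)))
   <= asymptotic_gain_rate D (rtimes_set CZ nu) (rtimes rho nu))%E.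
Proof.
have TZ_gt0 : (0 < #|TZ|)%N.
  case: nu_distr => _ nu1; rewrite lt0n; apply/negP => /eqP TZ0.
  move: nu1; rewrite big_pred0 => [/eqP|z]; first by rewrite eq_sym oner_eq0.
  by have := fintype0 z TZ0.
have unif_gt0 z : 0 < @unif R TZ z by rewrite invr_gt0 ltr0n.
(* The likelihood ratio [unif / nu] is the same for every [sigma], so a single [W] serves the whole
   family. *)
pose W (cz : TC * TZ) := B cz * unif cz.2 / nu cz.2.
have EW sigma : CZ sigma -> fin_expectation (rtimes sigma nu) W =
    fin_expectation (rtimes sigma (@unif R TZ)) B.
  move=> CZ_sigma; have sigma_distr := CZ_distr _ CZ_sigma.
  rewrite !fin_expectationE; first last.
  - by case: (rtimes_distr sigma_distr nu_distr).
  - by case: (rtimes_distr sigma_distr (unif_distr TZ_gt0)).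
  apply: eq_bigr => -[c z] _; rewrite /W /rtimes /=.
  by field; rewrite gt_eqF.
have S_distr mu : rtimes_set CZ nu mu -> is_distr mu.
  by move=> [sigma CZ_sigma <-]; apply: rtimes_distr => //; exact: CZ_distr.
have W_bound mu : rtimes_set CZ nu mu -> forall d z,
    gamma (d, z) * condD D mu d z <= 1 - fin_expectation mu W.
  move=> [sigma CZ_sigma <-] d z.
  have := B_bound (rtimes sigma (@unif R TZ)) (imageP _ CZ_sigma) d z.
  by rewrite EW// !condD_rtimes//; exact: CZ_distr.
have S_rho : rtimes_set CZ nu (rtimes rho nu) by exact: imageP.
have rho_distr := S_distr _ S_rho.
have EW_rho : fin_expectation (rtimes rho nu) W = bbar by rewrite EW ?bbarE.
have b_lt1 : bbar < 1.
  (* At a point of positive probability, [1 - bbar] dominates a positive [gamma * condD]. Without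
     such a point the expectation would be an empty sum, hence 0. *)
  have [[c z] /= rho_gt0|rho0] := pickP [pred cz | 0 < rtimes rho nu cz].
    rewrite -subr_gt0 -EW_rho; apply: lt_le_trans (W_bound _ S_rho (D c) z).
    rewrite mulr_gt0// condD_rtimes//; last exact: CZ_distr.
    have [rho_ge0 _] := CZ_distr _ CZ_rho z.
    rewrite (bigD1 c)//= ltr_wpDr ?sumr_ge0//.
    by move: rho_gt0; rewrite /rtimes/= pmulr_lgt0.
  by rewrite -EW_rho /fin_expectation big_pred0.
have b1_gt0 : 0 < 1 - bbar by rewrite subr_gt0.
pose A (cz : TC * TZ) := (W cz - bbar) / (1 - bbar).
have EA : fin_expectation (rtimes rho nu) A = 0.
  transitivity (fin_expectation (rtimes rho nu)
    (fun cz => - bbar / (1 - bbar) + (1 - bbar)^-1 * W cz)).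
    by apply: eq_bigr => cz _; rewrite /A; congr (_ * _); ring.
  by rewrite fin_expectation_affine// EW_rho; field; rewrite gt_eqF.
pose g (cz : TC * TZ) := gamma (D cz.1, cz.2) / (1 - bbar).
have g_gt0 cz : 0 < g cz by rewrite divr_gt0.
rewrite fin_expectation_log//= /log lne_EFin// -EFinN -EFinD.
rewrite (_ : _ + _ = fin_expectation (rtimes rho nu) (fun cz => ln (g cz)));
  last first.
  transitivity (fin_expectation (rtimes rho nu) (fun cz =>
    - ln (1 - bbar) + 1 * ln (gamma (D cz.1, cz.2)))).
    by rewrite fin_expectation_affine// mul1r.
  by apply: eq_bigr => cz _; rewrite ln_div ?posrE// mul1r addrC.
(* The supremum is only approached: each [eps] gets its own power [beta] and its own PEF. *)
apply/lee_addgt0Pr => eps eps_gt0.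
have [beta [beta_gt0 A_small A2_small]] := ex_small_scale A eps_gt0.
rewrite -leeBlDr// -EFinB.
apply: le_trans (tangent_log_prob_rate_ge rho_distr g_gt0 EA beta_gt0
  A_small A2_small) _.
apply: ereal_sup_ubound; eexists; eexists; split; last reflexivity.
apply: tangent_PEF => // cz.
by have := A_small cz; rewrite ler_norml /A => /andP[]; lra.
Qed.
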